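(* Let $X=(X(t))_{t\in\mathbb{R}}$ be the positive supOU process with characteristics $\pi$ and $\lambda$ (as defined in the context). Assume that $\int_{(0,1]} z\,\lambda(\mathrm{d}z)<\infty$, $m_0(\pi)=\pi((0,\infty))<\infty$, and that for some $0<c<c'<\infty$ $$\int_{(1,\infty)}e^{cz}\,\lambda(\mathrm{d}z)<\infty,\qquad \int_{(1,\infty)}e^{c'z}\,\lambda(\mathrm{d}z)=\infty.$$ Then $$\frac{1}{c'}\le\limsup_{t\to\infty}\frac{X(t)}{\log t}\le\frac{2}{c}\quad\text{almost surely.}$$
   Context: For a measure $Q$ on $(0,\infty)$ write $m_p(Q)=\int_{(0,\infty)}x^p\,Q(\mathrm{d}x)$. Setting: $\pi$ is a nonzero measure on $(0,\infty)$ with $m_{-1}(\pi)=\int_{(0,\infty)}x^{-1}\pi(\mathrm{d}x)<\infty$. $\lambda$ is a Lévy measure on $(0,\infty)$, i.e. $\int_{(0,\infty)}(1\wedge z^2)\lambda(\mathrm{d}z)<\infty$, satisfying $\int_{(1,\infty)}\log z\,\lambda(\mathrm{d}z)<\infty$. $\mu$ is a Poisson random measure on $(0,\infty)\times\mathbb{R}\times(0,\infty)$ with intensity measure $\nu(\mathrm{d}x,\mathrm{d}s,\mathrm{d}z)=\pi(\mathrm{d}x)\,\mathrm{d}s\,\lambda(\mathrm{d}z)$, with points $(\xi_k,\tau_k,\zeta_k)_{k\ge 0}$. When $\int_{(0,1]}z\,\lambda(\mathrm{d}z)<\infty$, the positive supOU process (drift chosen so that there is no centering) is $$X(t)=\sum_{k:\tau_k\le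 t}e^{-\xi_k(t-\tau_k)}\zeta_k,\qquad t\in\mathbb{R}.$$ *)

(* Defs.v *)
From HB Require Import structures.
From mathcomp Require Import all_boot all_order all_algebra.
From mathcomp Require Import all_classical all_reals all_analysis measurable_realfun.

Set Implicit Arguments.
Unset Strict Implicit.
Unset Printing Implicit Defensive.

Import Order.TTheory GRing.Theory Num.Theory.
Import numFieldNormedType.Exports.

Local Open Scope classical_set_scope.
Local Open Scope ring_scope.
Local Open Scope ereal_scope.

(* Measures on (0,+oo) are represented as Borel measures on R that do not
   charge ]-oo, 0]. *)
Definition on_pos (R : realType) (Q : {measure set (measurableTypeR R) -> \bar R})
    : Prop :=
  Q `]-oo, 0%R]%classic = 0.

Definition moment (R : realType) (Q : {measure set (measurableTypeR R) -> \bar R})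
    (p : R) : \bar R :=
  \int[Q]_(x in `]0%R, +oo[) (x `^ p)%:E.

Definition levy_measure (R : realType)
    (Q : {measure set (measurableTypeR R) -> \bar R}) : Prop :=
  on_pos Q /\
  \int[Q]_(z in `]0%R, +oo[) (Num.min 1 (z ^+ 2))%:E < +oo.

(* The family is finite and the A i may be setT, so the product rule for all
   subfamilies is included. *)
Definition mutually_independent (R : realType) (d d' : measure_display)
    (Omega : measurableType d) (T : measurableType d') (P : probability Omega R)
    (n : nat) (Y : 'I_n -> Omega -> T) : Prop :=
  forall A : 'I_n -> set T, (forall i, measurable (A i)) ->
    P (\bigcap_(i in [set: 'I_n]) (Y i @^-1` A i)) =
    \prod_(i < n) P (Y i @^-1` A i).

(* The Poisson weights are written out, since [poisson_pmf 0] is not the mass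
   function of the Dirac mass at 0. *)
Record poisson_random_measure (R : realType) (d d' : measure_display)
    (Omega : measurableType d) (T : measurableType d') (P : probability Omega R)
    (nu : set T -> \bar R) (mu : Omega -> set T -> \bar R) : Prop := {
  prm_measurable : forall B, measurable B ->
    measurable_fun [set: Omega] (fun w => mu w B) ;
  prm_poisson : forall B, measurable B -> nu B < +oo -> forall n : nat,
    P [set w | mu w B = n%:R%:E] =
    (fine (nu B) ^+ n / n`!%:R * expR (- fine (nu B)))%:E ;
  prm_infinite : forall B, measurable B -> nu B = +oo ->
    P [set w | mu w B = +oo] = 1 ;
  prm_independent : forall (n : nat) (B : 'I_n -> set T),
    (forall i, measurable (B i)) -> trivIset [set: 'I_n] B ->
    mutually_independent P (fun i w => mu w (B i)) }.

Definition point_measure (R : realType) (d' : measure_display) (Omega : Type)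
    (T : measurableType d') (pt : nat -> Omega -> T) (w : Omega) :
    set T -> \bar R :=
  mseries (fun k => @dirac _ T (pt k w) R) 0.

Notation supOU_space R :=
  (measurableTypeR R * (measurableTypeR R * measurableTypeR R))%type.

Definition supOU_intensity (R : realType)
    (pi lambda : {measure set (measurableTypeR R) -> \bar R}) :
    set (supOU_space R) -> \bar R :=
  pi \x (@lebesgue_measure R \x lambda).

Definition supOU_points (R : realType) (d : measure_display)
    (Omega : measurableType d) (P : probability Omega R)
    (pi lambda : {measure set (measurableTypeR R) -> \bar R})
    (xi tau zeta : nat -> {RV P >-> R}) : Prop :=
  (forall k w, (0 < xi k w)%R /\ (0 < zeta k w)%R) /\
  poisson_random_measure P (supOU_intensity pi lambda)
    (point_measure R
      (fun k w => (xi k w, (tau k w, zeta k w)) : supOU_space R)).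

(* The value is extended-real: the series has nonnegative terms and may a
   priori diverge. *)
Definition supOU (R : realType) (Omega : Type) (xi tau zeta : nat -> Omega -> R)
    (t : R) (w : Omega) : \bar R :=
  \sum_(k <oo | (tau k w <= t)%R)
    (expR (- (xi k w * (t - tau k w))) * zeta k w)%:E.

(* Main.v *)
Require Import Defs.
From HB Require Import structures.
From mathcomp Require Import all_boot all_order all_algebra.
From mathcomp Require Import all_classical all_reals all_analysis measurable_realfun.
From mathcomp Require Import ring lra finmap.

Set Implicit Arguments.
Unset Strict Implicit.
Unset Printing Implicit Defensive.

Import Order.TTheory GRing.Theory Num.Theory.
Import numFieldNormedType.Exports.

Local Open Scope classical_set_scope.
Local Open Scope ring_scope.
Local Open Scope ereal_scope.

(** The lower bound comes from single jumps, the upper bound from exponential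
    moments that are uniform in time.

    Lower bound.  At a jump time tau_k the process is at least zeta_k
    ([supOU_ge_jump]).  Fubini gives that the region of points with s > M and
    z > log s / c' has intensity
      pi(0,oo) * int (e^(c' z) - M)^+ lambda(dz) = +oo
    ([supOU_intensity_exceedance_region]), so for every M it almost surely
    contains a point of mu.  Hence there are arbitrarily late jumps with
    zeta_k > log tau_k / c', and X(tau_k) / log tau_k >= 1 / c' at these times.

    Upper bound.  On [n, n+1) the process is dominated by one sum over the
    points, sum_k f_n(xi_k, tau_k, zeta_k), where
      f_n(x, s, z) = 1_(s <= n+1) e^(-x (n-s)^+) z
    keeps the jumps of (n, n+1] undamped and stops the damping of the others
    at time n ([supOU_le_sum_envelope]).  By convexity of the exponential, f
    being z times a weight in [0, 1],
      e^(c f_n) - 1 <= 1_(s <= n+1) e^(-x (n-s)^+) (e^(c z) - 1),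
    and the time integral of the weight is 1 + 1/x, so
      int (e^(c f_n) - 1) dnu
        <= (m_0(pi) + m_(-1)(pi)) * int (e^(c z) - 1) lambda(dz) =: K < +oo
    uniformly in n ([integral_expR_supOU_envelope_le]).  The Chernoff bound
    for Poisson integrals ([poisson_random_measure_tail]) gives
      P(c sum_k f_n > 2 log n) <= e^K n^(-2),
    which is summable; by Borel-Cantelli c X(t) <= 2 log t for all large t.
    In fact any exponent larger than 1 could replace 2 in this argument.

    The Chernoff bound is proved from the defining properties of a Poisson
    random measure: a positive simple function integrates to a finite linear
    combination of independent Poisson variables, for which the exponential
    moment factorizes ([independent_poisson_tail]), and a general function is
    an increasing limit of simple ones. *)

(** * Chernoff bound for independent Poisson variables *)

Lemma sum_exp_coeff_le_expR (R : realType) (x : R) (m : nat) : (0 <= x)%R ->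
  (\sum_(i < m) x ^+ i / i`!%:R <= expR x)%R.
Proof.
move=> x0.
have := @nondecreasing_cvgn_le R (series (exp_coeff x)) _ (is_cvg_series_exp_coeff x) m.
rewrite /series /= big_mkord; apply.
apply/nondecreasing_seqP => n; rewrite /series/= big_nat_recr//= lerDl.
exact: exp_coeff_ge0.
Qed.

(** The Poisson weights sum to one, so no mass is left for the value +oo. *)
Lemma poisson_ae_nat (R : realType) (d : measure_display) (Omega : measurableType d)
    (P : probability Omega R) (N : Omega -> \bar R) (r : R) :
  (0 <= r)%R -> measurable_fun [set: Omega] N ->
  (forall n : nat, P [set w | N w = n%:R%:E] = (r ^+ n / n`!%:R * expR (- r))%:E) ->
  P.-negligible [set w | ~ exists n : nat, N w = n%:R%:E].
Proof.
move=> r0 mN PN.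
pose F (n : nat) := [set w | N w = n%:R%:E].
have mF n : measurable (F n).
  have -> : F n = [set: Omega] `&` N @^-1` [set n%:R%:E] by rewrite setTI.
  exact: mN.
have tF : trivIset [set: nat] F.
  apply/trivIsetP => i j _ _ ij; rewrite -subset0 => w [/= Ni Nj].
  by move/eqP: Nj; rewrite Ni eqe eqr_nat (negbTE ij).
have PF : P (\bigcup_n F n) = 1.
  rewrite measure_bigcup//=.
  transitivity ((expR (- r))%:E * (expR r)%:E); last first.
    by rewrite -EFinM expRN mulVf ?gt_eqF ?expR_gt0.
  rewrite (eq_eseriesr (g := fun n => (expR (- r))%:E * (exp_coeff r n)%:E)); last first.
    by move=> n _; rewrite PN -EFinM mulrC.
  rewrite nneseriesZl//=; last by move=> n _; rewrite lee_fin exp_coeff_ge0.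
  congr (_ * _); rewrite /expR -EFin_lim; last exact: is_cvg_series_exp_coeff.
  apply/congr_lim; apply/funext => n/=; rewrite -sumEFin.
  by apply: eq_bigl => i; rewrite in_setT.
have -> : [set w | ~ exists n : nat, N w = n%:R%:E] = ~` (\bigcup_n F n).
  apply/seteqP; split=> w /=; first by move=> h [n _ nw]; apply: h; exists n.
  by move=> h [n nw]; apply: h; exists n.
have mUF : measurable (\bigcup_n F n) by exact: bigcup_measurable.
apply/negligibleP; first exact: measurableC.
by have := probability_setC P mUF; rewrite PF subee.
Qed.

Lemma measure_nondecreasing_bigcup_le (R : realType) (d : measure_display)
    (T : measurableType d) (mu : {measure set T -> \bar R})
    (F : nat -> set T) (K : \bar R) :
  (forall n, measurable (F n)) -> nondecreasing_seq F ->
  (forall n, mu (F n) <= K) -> mu (\bigcup_n F n) <= K.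
Proof.
move=> mF ndF FK.
have cF := nondecreasing_cvg_mu (mu := mu) mF (bigcup_measurable (fun n _ => mF n)) ndF.
rewrite -(cvg_lim _ cF)//; apply: lime_le; first by apply/cvg_ex; eexists; exact: cF.
by apply: nearW => n; exact: FK.
Qed.

(** On the event that all N i are natural numbers below a bound m the claim is
    a finite computation: the event is a union over maps phi from 'I_n to 'I_m
    of events of product probability, Markov's inequality multiplies each of
    them by e^(sum a i * phi i - L), and distributivity turns the sum over all
    phi into a product of truncated exponential series.  Then m tends to
    infinity, which loses only the null event that some N i is not a natural
    number.  No sign is imposed on a. *)
Lemma independent_poisson_tail (R : realType) (d : measure_display)
    (Omega : measurableType d) (P : probability Omega R) (n : nat)
    (N : 'I_n -> Omega -> \bar R) (r a : 'I_n -> R) (L : R) :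
  (forall i, measurable_fun [set: Omega] (N i)) ->
  mutually_independent P N ->
  (forall i, 0 <= r i)%R ->
  (forall i (k : nat), P [set w | N i w = k%:R%:E] =
     (r i ^+ k / k`!%:R * expR (- r i))%:E) ->
  P [set w | L%:E < \sum_(i < n) (a i)%:E * N i w] <=
  (expR (\sum_(i < n) r i * (expR (a i) - 1) - L))%:E.
Proof.
move=> mN indN r0 PN; set A := [set w | _].
have mA : measurable A.
  rewrite -[X in measurable X]setTI; apply: measurable_lte => //.
  by apply: emeasurable_sum => i; exact: measurable_funeM.
set K : R := expR _.
pose E (m : nat) (phi : {ffun 'I_n -> 'I_m}) :=
  \bigcap_(i in [set: 'I_n]) (N i @^-1` [set (phi i)%:R%:E]).
have mE m phi : measurable (@E m phi).
  apply: fin_bigcap_measurable => // i _.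
  by rewrite -[X in measurable X]setTI; exact: mN.
have PE m phi : P (@E m phi) =
    (\prod_(i < n) (r i ^+ phi i / (phi i)`!%:R * expR (- r i)))%:E.
  rewrite /E indN//.
  by rewrite -prodEFin; apply: eq_bigr => i _; rewrite -PN.
pose B m := \big[setU/set0]_(phi : {ffun 'I_n -> 'I_m} |
  (L < \sum_(i < n) a i * (phi i)%:R)%R) @E m phi.
have mB m : measurable (B m) by apply: bigsetU_measurable => phi _; exact: mE.
have BK m : P (B m) <= K%:E.
  apply: (@le_trans _ _ (\sum_(phi : {ffun 'I_n -> 'I_m} |
      (L < \sum_(i < n) a i * (phi i)%:R)%R) P (@E m phi))).
    rewrite /B; elim: (index_enum _) => [|phi s ih]; first by rewrite !big_nil measure0.
    rewrite !big_cons; case: ifPn => // _.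
    apply: le_trans (leeD2l _ ih); apply: measureU2; first exact: mE.
    by apply: bigsetU_measurable => ? _; exact: mE.
  under eq_bigr do rewrite PE.
  rewrite sumEFin lee_fin.
  apply: (@le_trans _ _ (\sum_(phi : {ffun 'I_n -> 'I_m})
     expR (- L) * \prod_(i < n) (expR (a i * (phi i)%:R) *
      (r i ^+ phi i / (phi i)`!%:R * expR (- r i))))%R).
    rewrite [leLHS]big_mkcond/=; apply: ler_sum => phi _.
    have p0 : (0 <= \prod_(i < n) (r i ^+ phi i / (phi i)`!%:R * expR (- r i)))%R.
      by apply: prodr_ge0 => i _; rewrite mulr_ge0 ?expR_ge0// divr_ge0// exprn_ge0.
    rewrite [leRHS](_ : _ = (expR (\sum_(i < n) a i * (phi i)%:R - L) *
        \prod_(i < n) (r i ^+ phi i / (phi i)`!%:R * expR (- r i)))%R); last first.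
      by rewrite big_split/= mulrA -expR_sum -expRD addrC.
    case: ifPn => [Lphi|_]; last by rewrite mulr_ge0// expR_ge0.
    by rewrite ler_peMl// ltW// expR_gt1 subr_gt0.
  rewrite -mulr_sumr -(bigA_distr_bigA (fun (i : 'I_n) (k : 'I_m) =>
    expR (a i * k%:R) * (r i ^+ k / k`!%:R * expR (- r i)))%R).
  rewrite /K addrC expRD ler_pM2l ?expR_gt0// expR_sum.
  apply: ler_prod => i _; apply/andP; split.
    by apply: sumr_ge0 => k _; rewrite !mulr_ge0 ?expR_ge0 ?invr_ge0 ?exprn_ge0.
  have -> : (\sum_(k < m) expR (a i * k%:R) * (r i ^+ k / k`!%:R * expR (- r i)) =
      expR (- r i) * \sum_(k < m) (r i * expR (a i)) ^+ k / k`!%:R)%R.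
    rewrite mulr_sumr; apply: eq_bigr => k _.
    by rewrite exprMn expRM_natr; ring.
  rewrite mulrBr mulr1 addrC expRD ler_pM2l ?expR_gt0//.
  by apply: sum_exp_coeff_le_expR; rewrite mulr_ge0 ?expR_ge0.
have ndB : nondecreasing_seq B.
  move=> m1 m2 m12; apply/subsetPset => w; rewrite /B -!bigcup_pred => -[/= phi Lphi Ew].
  exists [ffun i => widen_ord m12 (phi i)] => /=.
    by rewrite unfold_in; under eq_bigr do rewrite ffunE.
  by move=> i _ /=; rewrite ffunE; exact: Ew.
have [Z [mZ Z0 hZ]] : P.-negligible
    (\big[setU/set0]_(i < n) [set w | ~ exists k : nat, N i w = k%:R%:E]).
  elim/big_ind : _ => //; first exact: negligible_set0.
    by move=> ? ? ? ?; exact: negligibleU.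
  by move=> i _; exact: poisson_ae_nat (r0 i) (mN i) (PN i).
have mUB : measurable (\bigcup_m B m) by exact: bigcup_measurable.
apply: (@le_trans _ _ (P ((\bigcup_m B m) `|` Z))).
  apply: le_measure => [||w Aw]; [exact/mem_set|exact/mem_set/measurableU|].
  have [Zw|nZw] := pselect (Z w); [by right|left].
  have /choice[k Nk] : forall i, exists k : nat, N i w = k%:R%:E.
    move=> i; apply: contrapT => nNi; apply/nZw/hZ.
    by rewrite (bigD1 i)//=; left.
  have km i : (k i < (\max_(i < n) k i).+1)%N by rewrite ltnS; exact: leq_bigmax.
  exists (\max_(i < n) k i).+1 => //; rewrite /B -bigcup_pred.
  exists [ffun i => Ordinal (km i)]; last by move=> i _ /=; rewrite ffunE Nk.
  rewrite /= unfold_in; under eq_bigr do rewrite ffunE /=.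
  move: Aw; rewrite /A /=; under eq_bigr do rewrite Nk -EFinM.
  by rewrite sumEFin lte_fin.
rewrite measureU0//; exact: measure_nondecreasing_bigcup_le.
Qed.

(** * Chernoff bound for Poisson random measures *)

Import HBNNSimple.

Lemma integral_point_measure (R : realType) (d' : measure_display) (Omega : Type)
    (T : measurableType d') (pt : nat -> Omega -> T) (w : Omega) (f : T -> R) :
  measurable_fun [set: T] f -> (forall x, 0 <= f x)%R ->
  \sum_(k <oo) (f (pt k w))%:E =
  \int[mseries (fun k => @dirac _ T (pt k w) R) 0]_x (f x)%:E.
Proof.
move=> mf f0; have mEf : measurable_fun [set: T] (EFin \o f) by exact/measurable_EFinP.
rewrite ge0_integral_measure_series//=; last by move=> x _; rewrite lee_fin.
by apply: eq_eseriesr => k _; rewrite integral_dirac// diracT mul1e.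
Qed.

(** The values of g that matter are the positive ones: the set where g vanishes
    may have infinite intensity, but contributes nothing to the sum, whereas
    every level set {g = a} with a > 0 has finite intensity because
    (e^a - 1) nu{g = a} <= K.  The counts of these level sets are independent
    Poisson variables. *)
Lemma poisson_random_measure_tail_nnsfun (R : realType) (d d' : measure_display)
    (Omega : measurableType d) (T : measurableType d') (P : probability Omega R)
    (nu : {measure set T -> \bar R}) (pt : nat -> Omega -> T)
    (g : {nnsfun T >-> R}) (K L : R) :
  poisson_random_measure P nu (point_measure R pt) ->
  \int[nu]_x (expR (g x) - 1)%:E <= K%:E ->
  measurable [set w | L%:E < \sum_(k <oo) (g (pt k w))%:E] /\
  P [set w | L%:E < \sum_(k <oo) (g (pt k w))%:E] <= (expR (K - L))%:E.
Proof.
move=> prm gK.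
pose s : seq R := [seq x <- enum_fset (fset_set (range g)) | (0 < x)%R].
have us : uniq s by rewrite filter_uniq// fset_uniq.
have s0 i : (i < size s)%N -> (0 < s`_i)%R.
  by move=> /(mem_nth 0%R); rewrite mem_filter => /andP[].
pose B (i : 'I_(size s)) := g @^-1` [set s`_i].
have mB i : measurable (B i) by exact: measurable_sfunP.
have tB : trivIset [set: 'I_(size s)] B.
  apply/trivIsetP => i j _ _ ij; rewrite -subset0 => x [/= gi gj].
  by move/eqP: gj; rewrite gi nth_uniq// (negbTE ij : (nat_of_ord i == j) = false).
have e0 (i : 'I_(size s)) : (0 < expR s`_i - 1)%R by rewrite subr_gt0 expR_gt1 s0.
have expB : \sum_(i < size s) (expR s`_i - 1)%:E * nu (B i) <= K%:E.
  apply: le_trans gK.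
  have -> : \sum_(i < size s) (expR s`_i - 1)%:E * nu (B i) =
      \sum_(i < size s) \int[nu]_x ((expR s`_i - 1)%:E * (\1_(B i) x)%:E).
    apply: eq_bigr => i _; rewrite ge0_integralZl_EFin//.
    - by rewrite integral_indic// setIT.
    - by apply/measurable_EFinP; exact: measurable_indic.
    - exact: ltW.
  rewrite -ge0_integral_sum//; last 2 first.
  - by move=> i; apply/measurable_funeM/measurable_EFinP; exact: measurable_indic.
  - by move=> i x _; rewrite mule_ge0// lee_fin ltW.
  apply: ge0_le_integral => //.
  - move=> x _; apply: sume_ge0 => i _.
    by rewrite mule_ge0// lee_fin// ltW.
  - apply: emeasurable_sum => i.
    by apply/measurable_funeM/measurable_EFinP; exact: measurable_indic.
  - apply/measurable_EFinP/measurable_funB => //.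
    exact: measurableT_comp.
  move=> x _; have [[i gxi]|nx] := pselect (exists i, B i x).
    rewrite (bigD1 i)//= big1 ?adde0 => [|j ji].
      by rewrite indicE mem_set// mule1 lee_fin gxi.
    rewrite indicE memNset ?mule0// => gxj.
    by move/trivIsetP: tB => /(_ _ _ I I ji)/seteqP[/(_ x (conj gxj gxi))].
  rewrite big1 => [|i _]; last by rewrite indicE memNset ?mule0// => Bix; apply: nx; exists i.
  by rewrite lee_fin subr_ge0 -[leLHS]expR0 ler_expR; exact: fun_ge0.
have nuB i : nu (B i) < +oo.
  have : (expR s`_i - 1)%:E * nu (B i) <= K%:E.
    apply: le_trans expB; rewrite (bigD1 i)//= leeDl//; apply: sume_ge0 => j _.
    by rewrite mule_ge0// lee_fin subr_ge0 -[leLHS]expR0 ler_expR ltW// s0.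
  rewrite ltey; apply: contraPN => /eqP ->.
  by rewrite gt0_muley ?lte_fin// leye_eq.
have sumE w : \sum_(k <oo) (g (pt k w))%:E =
    \sum_(i < size s) (s`_i)%:E * point_measure R pt w (B i).
  rewrite (integral_point_measure pt w) ?integralT_nnsfun//=.
  rewrite sintegralE fsbig_finite//=.
  rewrite (bigID (fun x => 0 < x)%R)/= [X in _ + X]big_seq_cond [X in _ + X]big1 ?adde0.
    by rewrite -big_filter (big_nth 0%R) big_mkord.
  move=> x /andP[]; rewrite in_fset_set// => /set_mem[y _ <-].
  rewrite -leNgt => gy0; suff -> : g y = 0%R by rewrite mul0e.
  by apply/eqP; rewrite eq_le gy0/=.
have mA : measurable
    [set w | L%:E < \sum_(i < size s) (s`_i)%:E * point_measure R pt w (B i)].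
  rewrite -[X in measurable X]setTI; apply: measurable_lte => //.
  apply: emeasurable_sum => i.
  by apply: measurable_funeM; exact: (prm_measurable prm).
under eq_set do rewrite sumE; split => //.
apply: le_trans (independent_poisson_tail
  (r := fun i => fine (nu (B i))) (fun i => s`_i) L _ _ _ _) _.
- by move=> i; exact: (prm_measurable prm).
- exact: (prm_independent prm).
- by move=> i; exact: fine_ge0.
- by move=> i k; exact: (prm_poisson prm).
rewrite lee_fin ler_expR lerD2r -lee_fin -sumEFin.
apply: le_trans expB; apply: lee_sum => i _.
by rewrite EFinM fineK ?ge0_fin_numE// muleC.
Qed.

(** This is P(int f dmu > L) <= e^(-L) E[e^(int f dmu)] with the exponential
    formula E[e^(int f dmu)] = e^(int (e^f - 1) dnu).  The simple functions
    g n increase to f, so the event for f is the increasing union of the events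
    for the g n, all of which obey the same bound. *)
Lemma poisson_random_measure_tail (R : realType) (d d' : measure_display)
    (Omega : measurableType d) (T : measurableType d') (P : probability Omega R)
    (nu : {measure set T -> \bar R}) (pt : nat -> Omega -> T)
    (f : T -> R) (K L : R) :
  poisson_random_measure P nu (point_measure R pt) ->
  measurable_fun [set: T] f -> (forall x, 0 <= f x)%R ->
  \int[nu]_x (expR (f x) - 1)%:E <= K%:E ->
  measurable [set w | L%:E < \sum_(k <oo) (f (pt k w))%:E] /\
  P [set w | L%:E < \sum_(k <oo) (f (pt k w))%:E] <= (expR (K - L))%:E.
Proof.
move=> prm mf f0 fK.
have mEf : measurable_fun [set: T] (EFin \o f) by exact/measurable_EFinP.
pose g := nnsfun_approx measurableT mEf.
have cg x : (EFin \o g^~ x) @ \oo --> (f x)%:E.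
  by apply: (cvg_nnsfun_approx measurableT mEf) => // y _; rewrite lee_fin.
have gf n x : (g n x <= f x)%R.
  have ndg : nondecreasing_seq (EFin \o g^~ x).
    by move=> a b ab; rewrite lee_fin; exact/lefP/nd_nnsfun_approx.
  rewrite -lee_fin -(cvg_lim _ (cg x))// (cvg_lim _ (ereal_nondecreasing_cvgn ndg))//.
  by apply: ereal_sup_ubound; exists n.
have gK n : \int[nu]_x (expR (g n x) - 1)%:E <= K%:E.
  apply: le_trans fK; apply: ge0_le_integral => //.
  - by move=> x _; rewrite lee_fin subr_ge0 -[leLHS]expR0 ler_expR; exact: fun_ge0.
  - by apply/measurable_EFinP/measurable_funB => //; exact: measurableT_comp.
  - by apply/measurable_EFinP/measurable_funB => //; exact: measurableT_comp.
  - by move=> x _; rewrite lee_fin lerD2r ler_expR.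
have gE n := poisson_random_measure_tail_nnsfun L prm (gK n).
have -> : [set w | L%:E < \sum_(k <oo) (f (pt k w))%:E] =
    \bigcup_n [set w | L%:E < \sum_(k <oo) (g n (pt k w))%:E].
  apply/seteqP; split=> w /=; last first.
    move=> [n _ /= /lt_le_trans]; apply.
    by apply: lee_nneseries => // k _; rewrite lee_fin.
  move=> Lw; apply: contrapT => nLw; move: Lw; apply/negP; rewrite -leNgt.
  rewrite (integral_point_measure pt w)//.
  pose mu : {measure set T -> \bar R} := mseries (fun k => @dirac _ T (pt k w) R) 0.
  have -> : \int[mu]_x (f x)%:E = limn (fun n => \int[mu]_x (g n x)%:E).
    rewrite -monotone_convergence//.
    - by apply: eq_integral => x _; rewrite (cvg_lim _ (cg x)).
    - by move=> n; exact/measurable_EFinP.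
    - by move=> n x _; rewrite lee_fin.
    - by move=> x _ a b ab; rewrite lee_fin; exact/lefP/nd_nnsfun_approx.
  apply: lime_le.
    apply: ereal_nondecreasing_is_cvgn => a b ab; apply: ge0_le_integral => //.
    - by move=> x _; rewrite lee_fin.
    - exact/measurable_EFinP.
    - exact/measurable_EFinP.
    - by move=> x _; rewrite lee_fin; exact/lefP/nd_nnsfun_approx.
  apply: nearW => n; rewrite /mu -(integral_point_measure pt w)// leNgt.
  by apply/negP => Ln; apply: nLw; exists n.
split; first by apply: bigcup_measurable => n _; have [] := gE n.
apply: measure_nondecreasing_bigcup_le => [n||n].
- by have [] := gE n.
- move=> m n mn; apply/subsetPset => w /= /lt_le_trans; apply.
  apply: lee_nneseries => k _; first by rewrite lee_fin.
  by rewrite lee_fin; exact/lefP/nd_nnsfun_approx.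
- by have [] := gE n.
Qed.

(** * The jump measure *)

(** The tangent to exp at t * y, evaluated at y and at 0, gives two lower bounds
    whose average with weights t and 1 - t is the claim. *)
Lemma expR_sub1_convex (R : realType) (t y : R) : (0 <= t <= 1)%R ->
  (expR (t * y) - 1 <= t * (expR y - 1))%R.
Proof.
move=> /andP[t0 t1].
have h1 : (expR (t * y) * (1 + (1 - t) * y) <= expR y)%R.
  have -> : expR y = (expR (t * y) * expR ((1 - t) * y))%R by rewrite -expRD; congr expR; ring.
  by rewrite ler_pM2l ?expR_gt0// expR_ge1Dx.
have h2 : (expR (t * y) * (1 - t * y) <= 1)%R.
  rewrite -[leRHS]expR0 -(subrr (t * y)%R) expRD ler_pM2l ?expR_gt0//.
  exact: expR_ge1Dx.
set E := expR (t * y) in h1 h2 *.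
have := lerD (ler_wpM2l t0 h1) (ler_wpM2l (_ : 0 <= 1 - t)%R h2).
rewrite subr_ge0 => /(_ t1); lra.
Qed.

Section levy.
Variables (R : realType) (lambda : {measure set (measurableTypeR R) -> \bar R}).
Hypothesis levy : levy_measure lambda.

(** The integrand 1 /\ z^2 is bounded below by a positive constant on
    [a, +oo[. *)
Lemma levy_measure_tail_lty (a : R) : (0 < a)%R -> lambda `[a, +oo[%classic < +oo.
Proof.
move=> a0; have [_ int_lty] := levy.
have m0 : (0 < Num.min 1 (a ^+ 2))%R by rewrite lt_min ltr01 exprn_gt0.
have mmin D : measurable D -> measurable_fun D (fun z : measurableTypeR R => (Num.min 1 (z ^+ 2))%:E).
  move=> mD; apply/measurable_EFinP/measurable_minr => //.
have : (Num.min 1 (a ^+ 2))%:E * lambda `[a, +oo[%classic < +oo.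
  apply: le_lt_trans int_lty.
  rewrite -integral_cst//; apply: (@le_trans _ _
    (\int[lambda]_(z in `[a, +oo[) (Num.min 1 (z ^+ 2))%:E)).
    apply: ge0_le_integral => //.
    - by move=> z _; rewrite lee_fin ltW.
    - exact: mmin.
    - move=> z; rewrite /= in_itv/= andbT => az; rewrite lee_fin.
      rewrite le_min2//.
      by rewrite lerXn2r ?nnegrE// (le_trans (ltW a0)).
  apply: ge0_subset_integral => //.
  - exact: mmin.
  - by move=> z _; rewrite lee_fin le_min ler01 sqr_ge0.
  - by move=> z; rewrite /= !in_itv/= !andbT; exact: lt_le_trans.
by rewrite !ltey; apply: contraNN => /eqP ->; rewrite gt0_muley.
Qed.

Lemma levy_measure_sigma_finite : sigma_finite [set: measurableTypeR R] lambda.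
Proof.
exists (fun n => `]-oo, 0%R]%classic `|` `[n.+1%:R^-1%R, +oo[%classic).
  apply/esym; rewrite -subTset => z _; have [z0|z0] := leP z 0%R.
    by exists 0%N => //; left; rewrite /= in_itv.
  exists (Num.truncn z^-1) => //; right; rewrite /= in_itv/= andbT.
  rewrite -[leRHS]invrK lef_pV2 ?posrE ?invr_gt0//.
  exact/ltW/truncnS_gt.
move=> n; split; first exact: measurableU.
apply: le_lt_trans (measureU2 _ _ _) _ => //.
rewrite [X in X + _](_ : _ = 0) ?add0e; last by have [] := levy.
by apply: levy_measure_tail_lty; rewrite invr_gt0.
Qed.

(** On ]0, 1] convexity gives e^(c z) - 1 <= (e^c - 1) z, so small jumps are
    controlled by their first moment. *)
Lemma levy_integral_expR_sub1_lty (c : R) : (0 < c)%R ->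
  \int[lambda]_(z in `]0%R, 1%R]) z%:E < +oo ->
  \int[lambda]_(z in `]1%R, +oo[) (expR (c * z))%:E < +oo ->
  \int[lambda]_z (expR (c * Num.max z 0) - 1)%:E < +oo.
Proof.
move=> c0 small large.
have mf : measurable_fun [set: measurableTypeR R]
    (fun z : measurableTypeR R => (expR (c * Num.max z 0) - 1)%:E).
  apply/measurable_EFinP/measurable_funB => //; apply: measurableT_comp => //.
  by apply: measurable_funM => //; exact: measurable_maxr.
have f0 (z : R) : 0 <= (expR (c * Num.max z 0) - 1)%:E.
  by rewrite lee_fin subr_ge0 -[leLHS]expR0 ler_expR mulr_ge0 ?(ltW c0)// le_max lexx orbT.
have -> : [set: measurableTypeR R] =
    `]-oo, 0%R]%classic `|` (`]0%R, 1%R]%classic `|` `]1%R, +oo[%classic).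
  apply/esym; rewrite -subTset => z _ /=; rewrite !in_itv/= andbT.
  have [z0|z0] := leP z 0%R; first by left.
  by right; have [z1|z1] := leP z 1%R; [left|right].
rewrite ge0_integral_setU//; last 3 first.
- exact: measurableU.
- exact: measurable_funTS.
- apply/disj_setPRL => z /=; rewrite !in_itv/= => -[/andP[z0 _]|].
    by rewrite leNgt z0.
  by rewrite andbT => z1; rewrite leNgt (lt_trans _ z1).
rewrite integral0_eq ?add0e; last first.
  move=> z; rewrite /= in_itv/= => z0.
  by rewrite max_r// mulr0 expR0 subrr.
rewrite ge0_integral_setU//; last 2 first.
- exact: measurable_funTS.
- apply/disj_setPRL => z /=; rewrite !in_itv/= andbT => z1.
  by rewrite leNgt z1 andbF.
apply: lte_add_pinfty.
  apply: (@le_lt_trans _ _ (\int[lambda]_(z in `]0%R, 1%R]) ((expR c - 1)%:E * z%:E))).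
    apply: ge0_le_integral => //.
    - exact: measurable_funTS.
    - apply/measurable_EFinP; exact: measurable_funM.
    move=> z; rewrite /= in_itv/= => /andP[z0 z1].
    rewrite max_l; last exact: ltW.
    rewrite -EFinM lee_fin (mulrC c) [leRHS]mulrC.
    by apply: expR_sub1_convex; rewrite ltW.
  rewrite ge0_integralZl_EFin//.
  - by rewrite lte_mul_pinfty// ?lee_fin// subr_ge0 ltW// expR_gt1.
  - by move=> z; rewrite /= in_itv/= lee_fin => /andP[/ltW].
  - by rewrite subr_ge0 ltW// expR_gt1.
apply: le_lt_trans large; apply: ge0_le_integral => //.
- exact: measurable_funTS.
- apply/measurable_EFinP; apply: measurable_funTS; apply: measurableT_comp => //.
- move=> z; rewrite /= in_itv/= andbT => z1.
  by rewrite lee_fin max_l ?gerBl// ltW// (lt_trans _ z1).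
Qed.
End levy.

(** * The intensity as a sigma-finite measure *)

Section sigma_finite_alias.
Context d (T : measurableType d) (R : realType).
Variable m : {measure set T -> \bar R}.

(** A copy of m that carries the given proof of sigma-finiteness, so that it can
    be used where a sigma-finite measure is expected; it unfolds to m. *)
Definition sigma_finite_alias of sigma_finite [set: T] m : set T -> \bar R := m.

Hypothesis sfm : sigma_finite [set: T] m.

HB.instance Definition _ := Measure.on (sigma_finite_alias sfm).
HB.instance Definition _ :=
  Measure_isSigmaFinite.Build _ _ _ (sigma_finite_alias sfm) sfm.

End sigma_finite_alias.

Lemma sigma_finite_product_measure d1 d2 (T1 : measurableType d1)
    (T2 : measurableType d2) (R : realType)
    (m1 : {sigma_finite_measure set T1 -> \bar R})
    (m2 : {sigma_finite_measure set T2 -> \bar R}) :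
  sigma_finite [set: T1 * T2] (m1 \x m2).
Proof.
have /sigma_finiteP[F [TF ndF Foo]] := sigma_finiteT m1.
have /sigma_finiteP[G [TG ndG Goo]] := sigma_finiteT m2.
exists (fun n => F n `*` G n).
  apply/esym; rewrite -subTset => -[x y] _.
  have [i _ Fx] : (\bigcup_i F i) x by rewrite -TF.
  have [j _ Gy] : (\bigcup_j G j) y by rewrite -TG.
  exists (maxn i j) => //; split=> /=.
    by move: x Fx; exact/subsetPset/ndF/leq_maxl.
  by move: y Gy; exact/subsetPset/ndG/leq_maxr.
move=> n; have [mF Fn] := Foo n; have [mG Gn] := Goo n.
split; first exact: measurableX.
by rewrite product_measure1E// lte_mul_pinfty// ge0_fin_numE.
Qed.

Definition time_jump_intensity (R : realType)
    (lambda : {sigma_finite_measure set (measurableTypeR R) -> \bar R}) :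
    {sigma_finite_measure set (measurableTypeR R * measurableTypeR R)%type -> \bar R} :=
  sigma_finite_alias (sigma_finite_product_measure (@lebesgue_measure R) lambda).

Definition supOU_intensity_measure (R : realType)
    (pi lambda : {sigma_finite_measure set (measurableTypeR R) -> \bar R}) :
    {sigma_finite_measure set (supOU_space R) -> \bar R} :=
  sigma_finite_alias (sigma_finite_product_measure pi (time_jump_intensity lambda)).

(** * Exponential moment of the envelope of the process on a unit interval *)

Lemma integral_exponential_half_line (R : realType) (t x : R) : (0 < x)%R ->
  \int[@lebesgue_measure R]_(s in `]-oo, t]) (expR (- (x * (t - s))))%:E = (x^-1)%:E.
Proof.
move=> x0.
have cE : continuous (fun s : R => expR (- (x * (t - s)))).
  move=> s; apply: continuous_comp; last exact: continuous_expR.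
  apply: continuousN; apply: continuousM; first exact: cst_continuous.
  by apply: continuousB => //; exact: cst_continuous.
have cF : continuous (fun s : R => expR (- (x * (t + s)))).
  move=> s; apply: continuous_comp; last exact: continuous_expR.
  apply: continuousN; apply: continuousM; first exact: cst_continuous.
  by apply: continuousD => //; exact: cst_continuous.
rewrite -[in `]-oo, t]](opprK t) ge0_integration_by_substitutionNy; last 2 first.
- exact: continuous_subspaceT.
- by move=> s _; exact: expR_ge0.
rewrite (@ge0_continuous_FTC2y _ _ (fun s => - x^-1 * expR (- (x * (t + s))))%R _ 0%R).
- by rewrite subrr mulr0 oppr0 expR0 mulr1 -EFinB sub0r opprK.
- by move=> s _; exact: expR_ge0.
- apply: continuous_subspaceT => s; apply: continuous_comp; last exact: cE.
  exact: opp_continuous.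
- rewrite -(mulr0 (- x^-1)%R); apply: cvgMr.
  apply: (@cvg_comp _ _ _ (fun s : R => x * (t + s))%R (fun y => expR (- y)) _ (pinfty_nbhs R)).
    by apply: gt0_cvgMry => //; exact: cvg_addrl.
  exact: cvgr_expR.
- move=> s _; exact: ex_derive.
- apply: cvg_at_right_filter; apply: cvgM; first exact: cvg_cst.
  exact: cF.
- move=> s _; rewrite derive1E /= derive_val /GRing.scale/= opprK add0r mulr1.
  by rewrite mulrN mulrNN mulrCA mulVf ?gt_eqF// mulr1.
Qed.

(** A bound, uniform over the observation times in [t, t + 1), for the damping of
    a jump at time s with decay rate x > 0: e^(-x (t - s)) for a jump before t,
    and 1 for a jump in ]t, t + 1].  The indicator of x > 0 makes the time
    integral finite for every x. *)
Definition decay_weight (R : realType) (t x s : R) : R :=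
  (\1_`]0%R, +oo[ x * \1_`]-oo, t + 1] s * expR (- (x * Num.max (t - s) 0)))%R.

(** A jump before t contributes the full exponential integral 1/x, the unit
    interval after t contributes its length.  The powers of x are those of the
    moments of order 0 and -1. *)
Lemma integral_decay_weight (R : realType) (t x : R) :
  \int[@lebesgue_measure R]_s (decay_weight t x s)%:E =
  (\1_`]0%R, +oo[ x * (x `^ 0 + x `^ (-1)))%R%:E.
Proof.
have [x0|x0] := leP x 0%R.
  have ix : (\1_`]0%R, +oo[ x = 0 :> R)%R.
    by rewrite indicE memNset//= in_itv/= andbT; apply/negP; rewrite -leNgt.
  rewrite ix mul0r integral0_eq// => s _.
  by rewrite /decay_weight ix !mul0r.
have ix : (\1_`]0%R, +oo[ x = 1 :> R)%R.
  by rewrite indicE mem_set//= in_itv/= andbT.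
have mw : measurable_fun [set: R] (fun s => expR (- (x * Num.max (t - s) 0)))%R.
  apply: measurableT_comp => //; apply: measurableT_comp => //.
  apply: measurable_funM => //; apply: measurable_maxr => //.
  exact: measurable_funB.
rewrite ix mul1r powRr0 powR_inv1 ?(ltW x0)//.
transitivity (\int[@lebesgue_measure R]_(s in `]-oo, (t + 1)%R])
    (expR (- (x * Num.max (t - s) 0)))%:E).
  rewrite [RHS]integral_mkcond; apply: eq_integral => s _.
  rewrite /decay_weight ix mul1r patchE indicE; case: ifPn => _; first by rewrite mul1r.
  by rewrite mul0r.
have -> : `]-oo, (t + 1)%R]%classic = `]-oo, t]%classic `|` `]t, (t + 1)%R]%classic :> set R.
  by rewrite -itv_bndbnd_setU// bnd_simp// lerDl.
rewrite ge0_integral_setU//; last 2 first.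
- exact/measurable_EFinP/measurable_funTS.
- apply/disj_setPRL => s /=; rewrite !in_itv/= => /andP[ts _].
  by apply/negP; rewrite -ltNge.
rewrite addeC EFinD; congr (_ + _).
  transitivity (\int[@lebesgue_measure R]_(s in `]t, (t + 1)%R]) (cst 1 s)).
    apply: eq_integral => s /set_mem; rewrite /= in_itv/= => /andP[ts _].
    by rewrite max_r ?subr_le0 ?(ltW ts)// mulr0 oppr0 expR0.
  rewrite integral_cst// mul1e.
  rewrite [LHS]lebesgue_measure_itv/= lte_fin ltrDl ltr01.
  by rewrite -EFinB addrAC subrr add0r.
rewrite -(integral_exponential_half_line t x0).
apply: eq_integral => s /set_mem; rewrite /= in_itv/= => st.
by rewrite max_l// subr_ge0.
Qed.

Definition supOU_envelope (R : realType) (t : R) (q : supOU_space R) : R :=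
  (decay_weight t q.1 q.2.1 * Num.max q.2.2 0)%R.

Section envelope.
Variables (R : realType).

Lemma decay_weight_itv01 (t x s : R) : (0 <= decay_weight t x s <= 1)%R.
Proof.
rewrite /decay_weight !indicE !mem_setE /= !in_itv/= andbT.
have [x0|] := ltP 0%R x; last by rewrite mulr0n !mul0r lexx ler01.
rewrite mulr1n mul1r; case: (s <= _)%R; last by rewrite mulr0n mul0r lexx ler01.
rewrite mulr1n mul1r expR_ge0/= -[leRHS]expR0 ler_expR oppr_le0 mulr_ge0 ?(ltW x0)//.
by rewrite le_max lexx orbT.
Qed.

Lemma measurable_decay_weight (t : R) :
  measurable_fun [set: supOU_space R] (fun q : supOU_space R => decay_weight t q.1 q.2.1).
Proof.
have ms : measurable_fun [set: supOU_space R] (fun q : supOU_space R => q.2.1).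
  exact: measurableT_comp measurable_fst measurable_snd.
have mi (i : interval R) : measurable_fun [set: measurableTypeR R] (\1_[set` i] : R -> R).
  exact: measurable_indic.
apply: measurable_funM; first apply: measurable_funM.
- exact: (measurableT_comp (mi _) measurable_fst).
- exact: (measurableT_comp (mi _) ms).
apply: measurableT_comp => //; apply: measurableT_comp => //.
apply: measurable_funM => //; apply: measurable_maxr => //.
exact: measurable_funB.
Qed.

Lemma measurable_supOU_envelope (t : R) :
  measurable_fun [set: supOU_space R] (supOU_envelope t).
Proof.
apply: measurable_funM; first exact: measurable_decay_weight.
apply: measurable_maxr => //.
exact: measurableT_comp measurable_snd measurable_snd.
Qed.

Lemma supOU_envelope_ge0 (t : R) q : (0 <= supOU_envelope t q)%R.
Proof.
have /andP[w0 _] := decay_weight_itv01 t q.1 q.2.1.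
by rewrite mulr_ge0// le_max lexx orbT.
Qed.

(** Convexity splits the weight from the jump size, which makes the majorant a
    product function of ((x, s), z); the bound does not depend on t because the
    time integral of the weight does not. *)
Lemma integral_expR_supOU_envelope_le
    (pi lambda : {sigma_finite_measure set (measurableTypeR R) -> \bar R}) (c t : R) :
  (0 < c)%R ->
  \int[supOU_intensity_measure pi lambda]_q (expR (c * supOU_envelope t q) - 1)%:E <=
  (moment pi 0%R + moment pi (-1)%R) *
  \int[lambda]_z (expR (c * Num.max z 0) - 1)%:E.
Proof.
move=> c0.
pose h (z : measurableTypeR R) : \bar R := (expR (c * Num.max z 0) - 1)%:E.
have h0 z : 0 <= h z.
  by rewrite lee_fin subr_ge0 -[leLHS]expR0 ler_expR mulr_ge0 ?(ltW c0)// le_max lexx orbT.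
have mh : measurable_fun setT h.
  apply/measurable_EFinP/measurable_funB => //; apply: measurableT_comp => //.
  by apply: measurable_funM => //; exact: measurable_maxr.
pose k (q : supOU_space R) : \bar R := (decay_weight t q.1 q.2.1)%:E * h q.2.2.
have w0 x s : 0 <= (decay_weight t x s)%:E.
  by rewrite lee_fin; have /andP[] := decay_weight_itv01 t x s.
have k0 q : 0 <= k q by rewrite mule_ge0.
have mk : measurable_fun setT k.
  apply: emeasurable_funM; first (apply/measurable_EFinP; exact: measurable_decay_weight).
  apply: measurableT_comp => //.
  exact: measurableT_comp measurable_snd measurable_snd.
have fk (mu : {measure set (supOU_space R) -> \bar R}) :
    \int[mu]_q (expR (c * supOU_envelope t q) - 1)%:E <= \int[mu]_q k q.
  apply: ge0_le_integral => //.
  - move=> q _; rewrite lee_fin subr_ge0 -[leLHS]expR0 ler_expR mulr_ge0 ?(ltW c0)//.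
    exact: supOU_envelope_ge0.
  - apply/measurable_EFinP/measurable_funB => //; apply: measurableT_comp => //.
    by apply: measurable_funM => //; exact: measurable_supOU_envelope.
  - move=> q _; rewrite /k /h -EFinM lee_fin /supOU_envelope mulrCA.
    apply: expR_sub1_convex; exact: decay_weight_itv01.
apply: (le_trans (fk (supOU_intensity_measure pi lambda))).
rewrite [leLHS](@fubini_tonelli1 _ _ _ _ _ pi (time_jump_intensity lambda) k mk k0).
have mw x : measurable_fun [set: measurableTypeR R] (fun s => (decay_weight t x s)%:E).
  apply/measurable_EFinP.
  apply: (measurableT_comp (f := fun q : supOU_space R => decay_weight t q.1 q.2.1)
    (g := fun s => (x, (s, 0%R)) : supOU_space R)).
    exact: measurable_decay_weight.
  by apply: measurable_fun_pair => //; exact: measurable_fun_pair.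
have -> : \int[pi]_x (fubini_F (time_jump_intensity lambda) k) x =
    \int[pi]_x ((\1_`]0%R, +oo[ x * (x `^ 0 + x `^ (-1)))%R%:E * \int[lambda]_z h z).
  apply: eq_integral => x _; rewrite /fubini_F.
  have mkx : measurable_fun setT (fun q => k (x, q)).
    apply: (measurableT_comp mk (g := fun q => (x, q))).
    exact: measurable_fun_pair.
  rewrite [LHS](@fubini_tonelli1 _ _ _ _ _ (@lebesgue_measure R) lambda _ mkx)//.
  transitivity (\int[@lebesgue_measure R]_s ((decay_weight t x s)%:E * \int[lambda]_z h z)).
    by apply: eq_integral => s _; rewrite /fubini_F /k/= ge0_integralZl.
  rewrite ge0_integralZr ?integral_decay_weight//; exact: integral_ge0.
rewrite ge0_integralZr//; last 3 first.
- apply/measurable_EFinP/measurable_funM; first exact: measurable_indic.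
  by apply: measurable_funD; exact: measurable_powR.
- by move=> x _; rewrite lee_fin mulr_ge0// addr_ge0// powR_ge0.
- exact: integral_ge0.
rewrite -ge0_integralD//; last 4 first.
- by move=> x _; rewrite lee_fin powR_ge0.
- by apply/measurable_EFinP/measurable_funTS; exact: measurable_powR.
- by move=> x _; rewrite lee_fin powR_ge0.
- by apply/measurable_EFinP/measurable_funTS; exact: measurable_powR.
rewrite [in leRHS]integral_mkcond le_eqVlt; apply/orP; left; apply/eqP; congr (_ * _).
apply: eq_integral => x _.
rewrite patchE indicE; case: ifPn => _; first by rewrite mul1r EFinD.
by rewrite mul0r.
Qed.
End envelope.

(** * The region of exceptionally large jumps *)

(** For c, M > 0 these are the jumps of size z > log s / c at a time s > M. *)
Definition exceedance_region (R : realType) (c M : R) : set (supOU_space R) :=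
  [set q | M < q.2.1 < expR (c * q.2.2)]%R.

Section exceedance.
Variables (R : realType) (c M : R).

Lemma measurable_exceedance_time_jump :
  measurable ([set q | M < q.1 < expR (c * q.2)]%R : set (measurableTypeR R * measurableTypeR R)).
Proof.
have -> : [set q : measurableTypeR R * measurableTypeR R | M < q.1 < expR (c * q.2)]%R =
    [set q : measurableTypeR R * measurableTypeR R | (cst M%:E) q < q.1%:E] `&`
    [set q : measurableTypeR R * measurableTypeR R | q.1%:E < (expR (c * q.2))%:E].
  apply/seteqP; split => q /=; rewrite !lte_fin; first by move=> /andP.
  by move=> [-> ->].
have m1 : measurable_fun [set: measurableTypeR R * measurableTypeR R] (fun q => q.1%:E : \bar R).
  by apply/measurable_EFinP; exact: measurable_fst.
have m2 : measurable_fun [set: measurableTypeR R * measurableTypeR R]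
    (fun q => (expR (c * q.2))%:E : \bar R).
  apply/measurable_EFinP; apply: measurableT_comp => //.
  by apply: measurable_funM => //; exact: measurable_snd.
apply: measurableI; rewrite -[X in measurable X]setTI; exact: measurable_lte.
Qed.

Lemma measurable_exceedance_region : measurable (exceedance_region c M).
Proof.
have -> : exceedance_region c M =
    setT `*` [set q : measurableTypeR R * measurableTypeR R | M < q.1 < expR (c * q.2)]%R.
  by apply/seteqP; split => q /=; [move=> ?; split|move=> []].
apply: measurableX => //; exact: measurable_exceedance_time_jump.
Qed.

(** For each z the admissible times form the interval ]M, e^(c z)[, whose length
    is at least e^(c z) - M, and the constant M has a finite integral over
    z > 1.  So Tonelli in the order (time, then jump size) gives +oo. *)
Lemma supOU_intensity_exceedance_region
    (pi : {measure set (measurableTypeR R) -> \bar R})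
    (lambda : {sigma_finite_measure set (measurableTypeR R) -> \bar R}) :
  (0 <= M)%R -> pi [set: R] != 0 -> lambda `]1%R, +oo[%classic < +oo ->
  \int[lambda]_(z in `]1%R, +oo[) (expR (c * z))%:E = +oo ->
  supOU_intensity pi lambda (exceedance_region c M) = +oo.
Proof.
move=> M0 pi0 lambda1 intoo; set E := exceedance_region c M.
pose E' := [set q : measurableTypeR R * measurableTypeR R | M < q.1 < expR (c * q.2)]%R.
have mE' : measurable E' by exact: measurable_exceedance_time_jump.
pose phi (z : measurableTypeR R) : \bar R := @lebesgue_measure R (ysection E' z).
have mphi : measurable_fun setT phi by exact: measurable_fun_ysection.
have phi0 z : 0 <= phi z by exact: measure_ge0.
have phiE : (@lebesgue_measure R \x lambda) E' = \int[lambda]_z phi z.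
  pose tl := time_jump_intensity lambda.
  have -> : (@lebesgue_measure R \x lambda) E' = \int[tl]_q (\1_E' q)%:E.
    by rewrite integral_indic// setIT.
  have mi : measurable_fun setT (EFin \o \1_E' : _ -> \bar R).
    by apply/measurable_EFinP; exact: measurable_indic.
  rewrite [LHS](@fubini_tonelli2 _ _ _ _ _ (@lebesgue_measure R) lambda _ mi)//; last first.
    by move=> q; rewrite lee_fin.
  apply: eq_integral => z _; rewrite /fubini_G/= /phi.
  rewrite -[in RHS](setIT (ysection _ _)) -integral_indic//; last exact: measurable_ysection.
  by apply: eq_integral => s _; rewrite !indicE mem_ysection.
have E'oo : (@lebesgue_measure R \x lambda) E' = +oo.
  apply/eqP; rewrite phiE -leye_eq.
  have le1 : +oo <= M%:E * lambda `]1%R, +oo[%classic + \int[lambda]_(z in `]1%R, +oo[) phi z.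
    rewrite -intoo -integral_cst// -ge0_integralD//; last exact: measurable_funTS.
    apply: ge0_le_integral => //.
    - by apply/measurable_EFinP/measurable_funTS; apply: measurableT_comp.
    - by apply: emeasurable_funD => //; exact: measurable_funTS.
    move=> z _.
    have -> : phi z = @lebesgue_measure R `]M, (expR (c * z))%R[%classic.
      rewrite /phi; congr lebesgue_measure; apply/seteqP.
      split => s; rewrite /ysection /= in_itv/=; first by move/set_mem.
      by move=> Ms; exact/mem_set.
    rewrite lebesgue_measure_itv/= lte_fin; case: ifPn => [_|].
      by rewrite -EFinB -EFinD lee_fin addrC subrK.
    by rewrite -leNgt adde0 lee_fin.
  have : +oo <= \int[lambda]_(z in `]1%R, +oo[) phi z.
    move: le1; rewrite !leye_eq addeC => /eqP/esym le1; apply: contra_eqT (esym le1).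
    rewrite -ltey => iphi; rewrite lt_eqF// lte_add_pinfty// lte_mul_pinfty//.
  move=> /le_trans; apply; apply: ge0_subset_integral => //.
rewrite /supOU_intensity /product_measure1.
rewrite (eq_integral (cst +oo)); last first.
  move=> x _; rewrite /= (_ : xsection E x = E')//.
  by apply/seteqP; split => q; rewrite /xsection/=; [move/set_mem|move=> ?; exact/mem_set].
rewrite integral_cst//.
by rewrite gt0_mulye// lt0e pi0 measure_ge0.
Qed.
End exceedance.

(** * Borel-Cantelli for quadratically decaying probabilities *)

(** Telescoping: 1/(k+1)^2 <= 1/k - 1/(k+1). *)
Lemma sum_inv_sqr_le2 (R : realType) (n : nat) :
  (\sum_(k < n) (k.+1%:R ^+ 2)^-1 <= 2 :> R)%R.
Proof.
case: n => [|n]; first by rewrite big_ord0.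
suff h : (\sum_(k < n.+1) (k.+1%:R ^+ 2)^-1 <= 2 - n.+1%:R^-1 :> R)%R.
  by apply: le_trans h _; rewrite gerBl invr_ge0.
elim: n => [|n ih]; first by rewrite big_ord1 expr1n invr1; lra.
rewrite big_ord_recr/=; apply: le_trans (lerD ih (lexx _)) _.
rewrite -addrA lerD2l.
set x : R := (n.+1%:R)%R; have x0 : (0 < x)%R by rewrite ltr0n.
have -> : (n.+2%:R = x + 1 :> R)%R by rewrite natr1.
have h : (((x + 1) ^+ 2)^-1 <= (x * (x + 1))^-1)%R.
  by rewrite lef_pV2 ?posrE ?exprn_gt0 ?mulr_gt0 ?addr_gt0// expr2 ler_pM2r ?addr_gt0// lerDl.
have e : (x^-1 - (x + 1)^-1 = (x * (x + 1))^-1)%R.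
  by field; rewrite !gt_eqF// addr_gt0.
by rewrite -lerBrDl opprK [leRHS]addrC e.
Qed.

Lemma borel_cantelli_expR_ln (R : realType) (d : measure_display)
    (Omega : measurableType d) (P : probability Omega R) (F : nat -> set Omega) (K : R) :
  (forall n, measurable (F n)) ->
  (forall n, P (F n) <= (expR (K - 2 * ln n.+1%:R))%:E) ->
  {ae P, forall w, exists n0, forall n, (n0 <= n)%N -> ~ F n w}.
Proof.
move=> mF PF.
have PF0 : P (lim_sup_set F) = 0.
  apply: lim_sup_set_cvg0 => //.
  apply: (@le_lt_trans _ _ (expR K * 2)%:E); last by rewrite ltry.
  apply: lime_le; first exact: is_cvg_nneseries.
  apply: nearW => n; rewrite big_mkord.
  apply: (@le_trans _ _ (\sum_(k < n) (expR K * (k.+1%:R ^+ 2)^-1)%:E)).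
    apply: lee_sum => k _; apply: le_trans (PF k) _.
    rewrite lee_fin expRD ler_pM2l ?expR_gt0// expRN lef_pV2 ?posrE ?expR_gt0 ?exprn_gt0//.
    by rewrite expRM_natl lnK// posrE ltr0n.
  by rewrite sumEFin -mulr_sumr lee_fin ler_pM2l ?expR_gt0// sum_inv_sqr_le2.
exists (lim_sup_set F); split => //.
  by apply: bigcap_measurable => // k _; exact: bigcup_measurable.
move=> w /= nw n _; apply: contrapT => nFw; apply: nw; exists n => j nj Fj.
by apply: nFw; exists j.
Qed.

(** * Bounds along one trajectory *)

Section paths.
Context (R : realType) (Omega : Type) (xi tau zeta : nat -> Omega -> R) (w : Omega).
Hypothesis pos : forall k, (0 < xi k w)%R /\ (0 < zeta k w)%R.

Local Notation pt k := ((xi k w, (tau k w, zeta k w)) : supOU_space R).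

Lemma supOU_le_sum_envelope (n t : R) : (n <= t < n + 1)%R ->
  supOU xi tau zeta t w <= \sum_(k <oo) (supOU_envelope n (pt k))%:E.
Proof.
move=> /andP[nt tn]; rewrite /supOU eseries_mkcond; apply: lee_nneseries => k _.
  by case: ifPn => // _ _; rewrite lee_fin mulr_ge0 ?expR_ge0// ltW; have [] := pos k.
have [xi0 zeta0] := pos k.
case: ifPn => [taut|_]; last by rewrite lee_fin supOU_envelope_ge0.
rewrite lee_fin /supOU_envelope /decay_weight/= !indicE !mem_setE !in_itv/= andbT xi0.
rewrite (le_trans taut (ltW tn)) !mulr1n !mul1r (max_l (ltW zeta0)).
by rewrite ler_pM2r// ler_expR lerN2 ler_pM2l// ge_max lerD2r nt/= subr_ge0.
Qed.

(** The k-th term of the sum is undamped at its own jump time. *)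
Lemma supOU_ge_jump (k : nat) : (zeta k w)%:E <= supOU xi tau zeta (tau k w) w.
Proof.
rewrite /supOU (@nneseriesD1 _ _ k)//=.
  rewrite subrr mulr0 oppr0 expR0 mul1r leeDl//; apply: nneseries_ge0 => j _ _.
  by rewrite lee_fin mulr_ge0 ?expR_ge0// ltW; have [] := pos j.
by move=> j _; rewrite lee_fin mulr_ge0 ?expR_ge0// ltW; have [] := pos j.
Qed.

(** The integer n with n + 1 <= t < n + 2 has log (n + 1) <= log t, so the bound
    along integers transfers to all times. *)
Lemma limf_esup_supOU_le (c : R) (n0 : nat) : (0 < c)%R ->
  (forall n, (n0 <= n)%N ->
    \sum_(k <oo) (c * supOU_envelope n.+1%:R (pt k))%:E <= (2 * ln n.+1%:R)%:E) ->
  limf_esup (fun t : R => supOU xi tau zeta t w * ((ln t)^-1)%:E)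
    (pinfty_nbhs R) <= (2 / c)%:E.
Proof.
move=> c0 hn0; rewrite limf_esupE; apply: ge_ereal_inf.
(* Times above n0 + 2 make log t positive and the index n at least n0. *)
pose V : set R := [set t | n0.+2%:R < t]%R.
exists (ereal_sup [set supOU xi tau zeta t w * ((ln t)^-1)%:E | t in V]).
  by exists V => //; exact: nbhs_pinfty_gt.
apply: ge_ereal_sup => _ [t /= n0t <-].
have t0 : (0 < t)%R by apply: lt_trans n0t; rewrite ltr0n.
have /andP[nt tn] : ((Num.truncn t)%:R <= t < (Num.truncn t).+1%:R)%R.
  by rewrite truncn_itv// ltW.
have : (n0.+2 <= Num.truncn t)%N by rewrite truncn_ge_nat ltW.
case: (Num.truncn t) nt tn => // n nt tn n0n.
have lnn : (0 < ln n.+1%:R :> R)%R.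
  by apply: ln_gt0; rewrite ltr1n; apply: leq_trans n0n.
have lnt : (ln n.+1%:R <= ln t)%R by rewrite ler_ln ?posrE ?ltr0n.
have Xt : supOU xi tau zeta t w <= (2 * ln n.+1%:R / c)%:E.
  apply: (@le_trans _ _ (\sum_(k <oo) (supOU_envelope n.+1%:R (pt k))%:E)).
    by apply: supOU_le_sum_envelope; rewrite nt natr1.
  rewrite EFinM lee_pdivlMr//.
  have := hn0 n (leq_trans (leqnSn _) n0n).
  under eq_eseriesr do rewrite EFinM.
  by rewrite nneseriesZl 1?muleC// => k _; rewrite lee_fin supOU_envelope_ge0.
apply: (@le_trans _ _ ((2 * ln n.+1%:R / c)%:E * ((ln t)^-1)%:E)).
  by apply: lee_wpmul2r Xt; rewrite lee_fin invr_ge0 (le_trans (ltW lnn)).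
have lnt0 := lt_le_trans lnn lnt.
by rewrite -EFinM lee_fin ler_pdivrMr// mulrAC ler_pM2l// divr_gt0.
Qed.

Lemma limf_esup_supOU_ge (c : R) : (0 < c)%R ->
  (forall n : nat, exists k, exceedance_region c n.+1%:R (pt k)) ->
  (1 / c)%:E <= limf_esup (fun t : R => supOU xi tau zeta t w * ((ln t)^-1)%:E)
    (pinfty_nbhs R).
Proof.
move=> c0 hn; rewrite limf_esupE; apply: le_ereal_inf_tmp => _ [V [M [_ MV]] <-].
have [k /andP[Mtau tauE]] := hn (Num.truncn M).
have tau1 : (1 < tau k w)%R by apply: le_lt_trans Mtau; rewrite ler1n.
have lntau : (0 < ln (tau k w))%R by exact: ln_gt0.
apply: (@le_trans _ _ (supOU xi tau zeta (tau k w) w * ((ln (tau k w))^-1)%:E)); last first.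
  apply: ereal_sup_ubound; exists (tau k w) => //; apply: MV.
  by apply: lt_trans Mtau; exact: truncnS_gt.
apply: (@le_trans _ _ ((zeta k w)%:E * ((ln (tau k w))^-1)%:E)); last first.
  by apply: lee_wpmul2r (supOU_ge_jump k); rewrite lee_fin invr_ge0 ltW.
rewrite -EFinM lee_fin ler_pdivlMr// mulrAC ler_pdivrMr// mul1r mulrC.
by rewrite -ler_expR lnK ?posrE ?(lt_trans ltr01)//; exact: ltW.
Qed.
End paths.

(** * Almost sure bounds for the limit superior *)

Lemma on_pos_setT (R : realType) (Q : {measure set (measurableTypeR R) -> \bar R}) :
  on_pos Q -> Q [set: measurableTypeR R] = Q `]0%R, +oo[%classic.
Proof.
move=> Q0; have -> : [set: measurableTypeR R] = `]0%R, +oo[%classic `|` `]-oo, 0%R]%classic.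
  apply/seteqP; split => // x _; rewrite /= !in_itv/= andbT.
  by have [x0|x0] := leP x 0%R; [right|left].
by rewrite measureU0.
Qed.

Lemma moment0E (R : realType) (Q : {measure set (measurableTypeR R) -> \bar R}) :
  moment Q 0%R = Q `]0%R, +oo[%classic.
Proof.
rewrite /moment (eq_integral (cst 1)) ?integral_cst ?mul1e// => x _.
by rewrite powRr0.
Qed.

Theorem corollary3 (R : realType) (d : measure_display)
  (Omega : measurableType d) (P : probability Omega R)
  (pi lambda : {measure set (measurableTypeR R) -> \bar R})
  (xi tau zeta : nat -> {RV P >-> R}) (c c' : R)
  (pi_pos : on_pos pi)
  (pi_neq0 : pi `]0%R, +oo[%classic != 0)
  (pi_m1 : moment pi (-1)%R < +oo)
  (lambda_levy : levy_measure lambda)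
  (lambda_log : \int[lambda]_(z in `]1%R, +oo[) (ln z)%:E < +oo)
  (points : supOU_points pi lambda xi tau zeta)
  (lambda_small : \int[lambda]_(z in `]0%R, 1%R]) z%:E < +oo)
  (pi_m0 : moment pi 0%R < +oo)
  (c_gt0 : (0 < c)%R) (c_lt_c' : (c < c')%R)
  (lambda_c : \int[lambda]_(z in `]1%R, +oo[) (expR (c * z))%:E < +oo)
  (lambda_c' : \int[lambda]_(z in `]1%R, +oo[) (expR (c' * z))%:E = +oo) :
  {ae P, forall w,
    (1 / c')%:E <=
      limf_esup (fun t : R => supOU xi tau zeta t w * ((ln t)^-1)%:E)
        (pinfty_nbhs R)
    <= (2 / c)%:E}.
Proof.
have [pos prm] := points.
have c'0 : (0 < c')%R by exact: lt_trans c_lt_c'.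
have piT : pi [set: measurableTypeR R] < +oo by rewrite on_pos_setT// -moment0E.
have sfp : sigma_finite [set: measurableTypeR R] pi.
  by apply: fin_num_fun_sigma_finite (lty_fin_num_fun piT); rewrite measure0.
have sfl := levy_measure_sigma_finite lambda_levy.
pose pi' : {sigma_finite_measure set (measurableTypeR R) -> \bar R} := sigma_finite_alias sfp.
pose lambda' : {sigma_finite_measure set (measurableTypeR R) -> \bar R} := sigma_finite_alias sfl.
pose pt := fun k w => ((xi k w, (tau k w, zeta k w)) : supOU_space R).
have prm' : poisson_random_measure P (supOU_intensity_measure pi' lambda') (point_measure R pt).
  exact: prm.
have lower : {ae P, forall w, forall n : nat, exists k, exceedance_region c' n.+1%:R (pt k w)}.
  apply: ae_foralln => n.
  pose B := exceedance_region c' n.+1%:R : set (supOU_space R).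
  have mB : measurable B by exact: measurable_exceedance_region.
  have nuB : supOU_intensity pi lambda B = +oo.
    apply: (@supOU_intensity_exceedance_region _ _ _ pi lambda') => //.
    - by rewrite on_pos_setT.
    - apply: le_lt_trans (levy_measure_tail_lty lambda_levy ltr01).
      apply: le_measure => [||z /=]; [exact/mem_set|exact/mem_set|].
      by rewrite !in_itv/= !andbT; exact: ltW.
  have mu1 := prm_infinite prm mB nuB.
  pose A := [set w | point_measure R pt w B = +oo].
  have mA : measurable A.
    rewrite (_ : A = [set: Omega] `&` (fun w => point_measure R pt w B) @^-1` [set +oo]).
      exact: (prm_measurable prm mB) _ (emeasurable_set1 _).
    by rewrite setTI.
  exists (~` A); split; first exact: measurableC.
    by have := probability_setC P mA; rewrite [P A]mu1 subee.
  move=> w /= nk Aw; apply: nk; apply: contrapT => nk.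
  move: Aw; rewrite /A /= /point_measure /mseries eseries0// => k _ _.
  by rewrite [LHS]diracE memNset// => Bk; apply: nk; exists k.
have upper : {ae P, forall w, exists n0, forall n, (n0 <= n)%N ->
    \sum_(k <oo) (c * supOU_envelope n.+1%:R (pt k w))%:E <= (2 * ln n.+1%:R)%:E}.
  pose K := fine ((moment pi 0 + moment pi (-1)%R) *
    \int[lambda]_z (expR (c * Num.max z 0) - 1)%:E).
  have exp_le n : \int[supOU_intensity_measure pi' lambda']_q
      (expR (c * supOU_envelope n.+1%:R q) - 1)%:E <= K%:E.
    rewrite fineK; first exact: integral_expR_supOU_envelope_le.
    have m_ge0 p : 0 <= moment pi p.
      by apply: integral_ge0 => x _; rewrite lee_fin powR_ge0.
    have int_ge0 : 0 <= \int[lambda]_z (expR (c * Num.max z 0) - 1)%:E.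
      apply: integral_ge0 => z _; rewrite lee_fin subr_ge0 -[leLHS]expR0 ler_expR.
      by rewrite mulr_ge0 ?(ltW c_gt0)// le_max lexx orbT.
    rewrite ge0_fin_numE; last by apply: mule_ge0 => //; exact: adde_ge0.
    apply: lte_mul_pinfty; [exact: adde_ge0| |exact: levy_integral_expR_sub1_lty].
    by rewrite ge0_fin_numE; [exact: lte_add_pinfty|exact: adde_ge0].
  have tail n := poisson_random_measure_tail (f := fun q => (c * supOU_envelope n.+1%:R q)%R)
    (2 * ln n.+1%:R) prm'
    (measurable_funM (measurable_cst _) (measurable_supOU_envelope _))
    (fun q => mulr_ge0 (ltW c_gt0) (supOU_envelope_ge0 _ q)) (exp_le n).
  have := borel_cantelli_expR_ln (fun n => (tail n).1) (fun n => (tail n).2).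
  apply: filterS => w [n0 hn0]; exists n0 => n n0n.
  by rewrite leNgt; apply/negP/hn0.
near=> w.
have h1 : forall n : nat, exists k, exceedance_region c' n.+1%:R (pt k w) by near: w.
have [n0 h2] : exists n0, forall n, (n0 <= n)%N ->
    \sum_(k <oo) (c * supOU_envelope n.+1%:R (pt k w))%:E <= (2 * ln n.+1%:R)%:E by near: w.
apply/andP; split.
- exact: limf_esup_supOU_ge.
- exact: limf_esup_supOU_le h2.
Unshelve. all: by end_near. Qed.
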